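(* Let $f:M\to M$ be a diffeomorphism of a closed manifold $M$, let $\Lambda\subset M$ be a compact $f$-invariant set, and let $k\ge 2$. If $f$ admits an $(n_1,\dots,n_k)$-dominated splitting over $\Lambda$ with decomposition $T_\Lambda M=E_1\oplus\cdots\oplus E_k$, then $f$ is reducible with respect to this same decomposition; that is, if $P_1,\dots,P_k$ denote the oblique projectors corresponding to the decomposition, there is a constant $K>0$ such that $$\|Df^n(x)P_i(x)Df^{-n}(f^n(x))\|\le K,\qquad i=1,\dots,k,$$ for all $n\in\mathbb Z$ and all $x\in\Lambda$.
   Context: $M$ is a closed $d$-dimensional manifold whose tangent bundle carries a continuous inner product, with induced norm $\|\cdot\|$ (also used for operator norms). For $n\in\mathbb Z$, $Df^n(x):T_xM\to T_{f^n(x)}M$ is the derivative of $f^n$ at $x$, so $Df^{-n}(f^n(x)):T_{f^n(x)}M\to T_xM$ is its inverse. $T_\Lambda M$ is the restriction of $TM$ to $\Lambda$. A splitting $T_xM=E_1(x)\oplus\cdots\oplus E_k(x)$, $x\in\Lambda$, is $Df$-invariant if $Df(x)E_i(x)=E_i(f(x))$ for all $x\in\Lambda$ and all $i$. The corresponding oblique projectors are the linear maps $P_i(x):T_xM\to T_xM$ with range $E_i(x)$ and kernel $\bigoplus_{j\ne i}E_j(x)$. Dominated splitting: a $Df$-invariant splitting $T_xM=E_1(x)\oplus\cdots\oplus E_k(x)$, $x\in\Lambda$ ($k\ge2$), with oblique projectors $P_1,\dots,P_k$, is dominated if there are constants $C>1$, $\alpha>0$ such that for every $i<j$, every $x\in\Lambda$,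 every $u,v\in T_xM$ and all $m,n\in\mathbb Z$ with $m\ge0$, $$\frac{\|Df^{n+m}(x)P_i(x)u\|\,\|Df^n(x)P_j(x)v\|}{\|Df^n(x)P_i(x)u\|\,\|Df^{n+m}(x)P_j(x)v\|}\le Ce^{-m\alpha},$$ whenever the denominator does not vanish. If in addition $n_i=\dim E_i$, one says that $f$ admits an $(n_1,\dots,n_k)$-dominated splitting over $\Lambda$ with decomposition $T_\Lambda M=E_1\oplus\cdots\oplus E_k$. *)

(* Defs.v *)
From mathcomp Require Import all_boot all_order all_algebra.
From mathcomp Require Import all_classical all_reals all_analysis.

Set Implicit Arguments.
Unset Strict Implicit.
Unset Printing Implicit Defensive.

Import Order.TTheory GRing.Theory Num.Theory.
Import numFieldNormedType.Exports.
Local Open Scope classical_set_scope.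
Local Open Scope ring_scope.

(* Meant for open U; continuity of the Jacobian at a point of an open set is
   then the same as continuity relative to U. *)
Definition C1_on (R : realType) (d : nat) (U : set 'rV[R]_d)
    (h : 'rV[R]_d -> 'rV[R]_d) : Prop :=
  forall p, U p -> differentiable h p /\ {for p, continuous (jacobian h)}.

(* A chart is a homeomorphism from an open set of M onto an open set of R^d.
   Both directions are total functions: the values of [coord] outside [dom],
   and of [param] outside [coord @` dom], are irrelevant. *)
Record chart (R : realType) (d : nat) (M : topologicalType) := Chart {
  dom : set M;
  coord : M -> 'rV[R]_d;
  param : 'rV[R]_d -> M;
  dom_open : open dom;
  range_open : open (coord @` dom);
  coordK : forall x, dom x -> param (coord x) = x;
  coord_continuous : {within dom, continuous coord};
  param_continuous : {within coord @` dom, continuous param} }.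

(* [chart_at] selects a preferred chart around each point.  It is used only to
   represent the tangent spaces by coordinates; any selection will do. *)
Record manifold (R : realType) (d : nat) := Manifold {
  carrier :> topologicalType;
  manifold_hausdorff : hausdorff_space carrier;
  manifold_second_countable : @second_countable carrier;
  atlas : set (chart R d carrier);
  atlas_C1 : forall c c', atlas c -> atlas c' ->
    C1_on (coord c @` (dom c `&` dom c')) (coord c' \o param c);
  chart_at : carrier -> chart R d carrier;
  chart_at_atlas : forall x, atlas (chart_at x);
  chart_at_dom : forall x, dom (chart_at x) x }.

(* T_x M: a tangent vector at x is given by its components in the preferred
   chart at x. *)
Definition tangent (R : realType) (d : nat) (M : manifold R d) (x : M) :
  vectType R := 'rV[R]_d.

(* The tangent vector at x with components a in the chart c around x. *)
Definition chart_vector (R : realType) (d : nat) (M : manifold R d)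
    (c : chart R d M) (x : M) (a : 'rV[R]_d) : tangent x :=
  'd (coord (chart_at x) \o param c) (coord c x) a.

(* Inner product on TM whose components in every chart of the atlas are
   continuous. *)
Record metric (R : realType) (d : nat) (M : manifold R d) := Metric {
  inner : forall x : M, tangent x -> tangent x -> R;
  innerC : forall x (u v : tangent x), inner u v = inner v u;
  inner_linear : forall x (a : R) (u v w : tangent x),
    inner (a *: u + v) w = a * inner u w + inner v w;
  inner_gt0 : forall x (u : tangent x), u != 0 -> 0 < inner u u;
  inner_continuous : forall c, atlas c -> forall a b : 'rV[R]_d,
    {within dom c, continuous
      (fun x => inner (chart_vector c x a) (chart_vector c x b))} }.

Definition tnorm (R : realType) (d : nat) (M : manifold R d) (g : metric M)
    (x : M) (u : tangent x) : R :=
  Num.sqrt (inner g u u).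

Definition opnorm (R : realType) (d : nat) (M : manifold R d) (g : metric M)
    (x y : M) (A : 'Hom(tangent x, tangent y)) : \bar R :=
  ereal_sup [set (tnorm g (A u))%:E | u in [set u | tnorm g u <= 1]].

Definition C1_map (R : realType) (d : nat) (M N : manifold R d)
    (h : M -> N) : Prop :=
  continuous h /\
  forall c c', atlas c -> atlas c' ->
    C1_on (coord c @` (dom c `&` h @^-1` dom c')) (coord c' \o h \o param c).

(* The derivative of h at x, expressed in the preferred charts at x and h x. *)
Definition tmap (R : realType) (d : nat) (M N : manifold R d) (h : M -> N)
    (x : M) : 'Hom(tangent x, tangent (h x)) :=
  linfun ('d (coord (chart_at (h x)) \o h \o param (chart_at x))
             (coord (chart_at x) x)).

Record diffeo (R : realType) (d : nat) (M : manifold R d) := Diffeo {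
  fwd :> M -> M;
  bwd : M -> M;
  fwdK : cancel fwd bwd;
  bwdK : cancel bwd fwd;
  fwd_C1 : C1_map fwd;
  bwd_C1 : C1_map bwd }.

Definition iterz (R : realType) (d : nat) (M : manifold R d) (f : diffeo M)
    (n : int) : M -> M :=
  match n with
  | Posz p => iter p f
  | Negz p => iter p.+1 (bwd f)
  end.

(* Df^n(x) *)
Definition Dpow (R : realType) (d : nat) (M : manifold R d) (f : diffeo M)
    (n : int) (x : M) : 'Hom(tangent x, tangent (iterz f n x)) :=
  tmap (iterz f n) x.

Section Splitting.
Context (R : realType) (d k : nat) (M : manifold R d).
Implicit Types (g : metric M) (f : diffeo M) (Lambda : set M).
Implicit Types (E : 'I_k -> forall x : M, {vspace tangent x}).
Implicit Types (P : 'I_k -> forall x : M, 'End(tangent x)).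

Definition is_splitting Lambda E : Prop :=
  forall x, Lambda x ->
    directv (\sum_(i < k) E i x) /\ (\sum_(i < k) E i x)%VS = fullv.

Definition invariant_splitting f Lambda E : Prop :=
  forall x, Lambda x -> forall i, (tmap f x @: E i x)%VS = E i (f x).

Definition oblique_projectors Lambda E P : Prop :=
  forall x, Lambda x -> forall i,
    [/\ (P i x \o P i x)%VF = P i x,
        limg (P i x) = E i x
      & lker (P i x) = (\sum_(j < k | j != i) E j x)%VS].

Definition dominated g f Lambda P : Prop :=
  exists C alpha : R, [/\ 1 < C, 0 < alpha &
    forall i j : 'I_k, (i < j)%N -> forall x, Lambda x ->
    forall (u v : tangent x) (m n : int), 0 <= m ->
      let num := tnorm g (Dpow f (n + m) x (P i x u)) *
                 tnorm g (Dpow f n x (P j x v)) in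
      let den := tnorm g (Dpow f n x (P i x u)) *
                 tnorm g (Dpow f (n + m) x (P j x v)) in
      den != 0 -> num / den <= C * expR (- (m%:~R * alpha))].

Record dominated_splitting g f Lambda (dims : 'I_k -> nat) E P : Prop :=
  DominatedSplitting {
    ds_splitting : is_splitting Lambda E;
    ds_dim : forall x, Lambda x -> forall i, \dim (E i x) = dims i;
    ds_invariant : invariant_splitting f Lambda E;
    ds_projectors : oblique_projectors Lambda E P;
    ds_dominated : dominated g f Lambda P }.

(* In Df^n(x) P_i(x) Df^{-n}(f^n(x)) the rightmost factor takes values in the
   tangent space at f^{-n}(f^n(x)), which is x. *)
Definition reducible g f Lambda P : Prop :=
  exists2 K : R, 0 < K & forall i (n : int) x, Lambda x ->
    (opnorm g (x := iterz f n x) (y := iterz f n x)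
       (Dpow f n x \o P i x \o Dpow f (- n) (iterz f n x))%VF <= K%:E)%E.

End Splitting.

(* Main.v *)
Require Import Defs.
From mathcomp Require Import all_boot all_order all_algebra.
From mathcomp Require Import all_classical all_reals all_analysis.
From mathcomp Require Import ring lra.

Set Implicit Arguments.
Unset Strict Implicit.
Unset Printing Implicit Defensive.

Import Order.TTheory GRing.Theory Num.Theory.
Import numFieldNormedType.Exports.
Local Open Scope classical_set_scope.
Local Open Scope ring_scope.

(** Let [w_l] be the component in [E_l] at [x], and measure a tangent vector at
    [x] by the norm of its image under [Df^n]; write [N_m] for the norm after
    [m] further iterations.  On a compact manifold [Df] and [Df^-1] are bounded,
    so [N_0] and [N_m] are comparable, uniformly in [x] and [n].  By induction
    on [p] one gets [sum_(l < p) N_0 w_l <= K_p * N_0 (sum_(l < p) w_l)]: let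
    [w] be the sum of the first [p] components and [v = w_p].  Unless [w] and
    [v] have quite different sizes, domination for [m] large in terms of [K_p]
    gives [N_m w <= N_m v / 2], so [N_0 v] is bounded by [N_m v], hence by
    [N_m (v + w)], hence by [N_0 (v + w)]. *)

(** * Differentials in charts and the chain rule *)

(** The first-order expansion at [x] depends only on the germ there, and it determines the
    differential. This is needed because [param] inverts [coord] only on the chart domain, so
    identities between chart representations hold only locally. *)
Lemma near_eq_diff (R : numFieldType) (V W : normedModType R) (f h : V -> W)
    (x : V) : (\forall y \near x, f y = h y) -> differentiable f x ->
  differentiable h x /\ 'd h x = 'd f x :> (V -> W).
Proof.
move=> fh df.
have hx : f x = h x by exact: nbhs_singleton fh.
have loc : h \o shift x = cst (h x) + 'd f x +o_ (0 : V) id.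
  apply/eqaddoP => e e0; have /eqaddoP/(_ e e0) := diff_locally df.
  have : \forall y \near (0 : V), f (y + x) = h (y + x).
    by move: fh; rewrite (near_shift 0 x) /= subr0.
  by apply: filterS2 => y E; rewrite !fctE /= E hx.
have dE : 'd h x = 'd f x :> (V -> W) by apply: diff_unique => //; exact: diff_continuous.
split=> //; apply/diff_locallyP; rewrite dE; split; first exact: diff_continuous.
exact: loc.
Qed.

Lemma coord_continuous_at (R : realType) d (M : topologicalType) (c : chart R d M) x :
  dom c x -> {for x, continuous (Defs.coord c)}.
Proof.
by move=> cx; have := @Defs.coord_continuous _ _ _ c; rewrite continuous_open_subspace;
  [apply; rewrite inE | exact: dom_open].
Qed.

Lemma near_dom (R : realType) d (M : topologicalType) (c : chart R d M) x :
  dom c x -> \forall y \near x, dom c y.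
Proof. by move=> cx; apply: open_nbhs_nbhs; split=> //; exact: dom_open. Qed.

Lemma param_cvg (R : realType) d (M : topologicalType) (c : chart R d M) x :
  dom c x -> param c @ Defs.coord c x --> x.
Proof.
move=> cx; have := @param_continuous _ _ _ c; rewrite continuous_open_subspace.
  have xc : Defs.coord c x \in [set Defs.coord c x | x in dom c].
    by rewrite inE; exists x.
  by move=> /(_ _ xc); rewrite /continuous_at coordK.
exact: range_open.
Qed.

Definition chart_rep (R : realType) (d : nat) (M N : manifold R d)
    (c : chart R d M) (c' : chart R d N) (h : M -> N) : 'rV[R]_d -> 'rV[R]_d :=
  Defs.coord c' \o h \o param c.

(* A weakening of [C1_map] that is immediately stable under composition. *)
Definition diff_map (R : realType) (d : nat) (M N : manifold R d)
    (h : M -> N) : Prop :=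
  continuous h /\
  forall c c' x, atlas c -> atlas c' -> dom c x -> dom c' (h x) ->
    differentiable (chart_rep c c' h) (Defs.coord c x).

Lemma C1_diff_map (R : realType) (d : nat) (M N : manifold R d) (h : M -> N) :
  C1_map h -> diff_map h.
Proof.
move=> [hc hd]; split=> // c c' x Ac Ac' cx chx.
by have [] := hd _ _ Ac Ac' (Defs.coord c x) (ex_intro2 _ _ x (conj cx chx) erefl).
Qed.

Lemma diff_map_id (R : realType) (d : nat) (M : manifold R d) :
  diff_map (@id M).
Proof.
split=> [x|c c' x Ac Ac' cx cx']; first exact: cvg_id.
by have [] := atlas_C1 Ac Ac' (ex_intro2 _ _ x (conj cx cx') erefl).
Qed.

Section ChartDiff.
Context (R : realType) (d : nat).
Implicit Types M N Q : manifold R d.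

Definition chart_diff M N (c : chart R d M) (c' : chart R d N) (h : M -> N)
    (x : M) (a : 'rV[R]_d) : 'rV[R]_d :=
  'd (chart_rep c c' h) (Defs.coord c x) a.

(** The usual chain rule, once the inner [param c' \o coord c'] cancels. It cancels where
    [h (param c p)] lies in [dom c'], which by continuity holds for [p] near [coord c x]. *)
Lemma chart_rep_comp M N Q (h : M -> N) (h' : N -> Q) c c' c'' x :
  diff_map h -> diff_map h' -> atlas c -> atlas c' -> atlas c'' ->
  dom c x -> dom c' (h x) -> dom c'' (h' (h x)) ->
  differentiable (chart_rep c c'' (h' \o h)) (Defs.coord c x) /\
  'd (chart_rep c c'' (h' \o h)) (Defs.coord c x) =
  'd (chart_rep c' c'' h') (Defs.coord c' (h x)) \o
    'd (chart_rep c c' h) (Defs.coord c x) :> ('rV[R]_d -> 'rV[R]_d).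
Proof.
move=> hd hd' Ac Ac' Ac'' cx chx chhx.
have d1 := hd.2 _ _ _ Ac Ac' cx chx.
have E : chart_rep c c' h (Defs.coord c x) = Defs.coord c' (h x).
  by rewrite /chart_rep /= coordK.
have d2 : differentiable (chart_rep c' c'' h') (chart_rep c c' h (Defs.coord c x)).
  by rewrite E; exact: hd'.2.
have d3 := differentiable_comp d1 d2.
have hp : h (param c p) @[p --> Defs.coord c x] --> h x.
  apply: cvg_comp; [exact: param_cvg cx | exact: hd.1].
have := diff_comp d1 d2; rewrite E => <-.
apply: near_eq_diff => //.
have /= : \forall p \near Defs.coord c x, dom c' (h (param c p)).
  exact: hp _ (near_dom chx).
by apply: filterS => p hcp; rewrite /chart_rep /= coordK.
Qed.

Lemma diff_map_comp M N Q (h : M -> N) (h' : N -> Q) :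
  diff_map h -> diff_map h' -> diff_map (h' \o h).
Proof.
move=> hd hd'; split=> [x|c c'' x Ac Ac'' cx chx].
  exact: continuous_comp (hd.1 x) (hd'.1 (h x)).
by have [] := chart_rep_comp hd hd' Ac (chart_at_atlas (h x)) Ac'' cx
  (chart_at_dom (h x)) chx.
Qed.

Lemma chart_diff_comp M N Q (h : M -> N) (h' : N -> Q) c c' c'' x a :
  diff_map h -> diff_map h' -> atlas c -> atlas c' -> atlas c'' ->
  dom c x -> dom c' (h x) -> dom c'' (h' (h x)) ->
  chart_diff c c'' (h' \o h) x a =
    chart_diff c' c'' h' (h x) (chart_diff c c' h x a).
Proof.
move=> hd hd' Ac Ac' Ac'' cx chx chhx.
have [_] := chart_rep_comp hd hd' Ac Ac' Ac'' cx chx chhx.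
by move=> /(congr1 (fun F => F a)).
Qed.

Lemma chart_diff_id M (c : chart R d M) x a : dom c x -> chart_diff c c id x a = a.
Proof.
move=> cx; rewrite /chart_diff.
have [_ ->] : differentiable (chart_rep c c id) (Defs.coord c x) /\
  'd (chart_rep c c id) (Defs.coord c x) = 'd id (Defs.coord c x)
    :> ('rV[R]_d -> 'rV[R]_d).
  apply: near_eq_diff; last by [].
  have : nbhs (Defs.coord c x) (Defs.coord c @` dom c).
    by apply: open_nbhs_nbhs; split; [exact: range_open | exists x].
  by apply: filterS => _ [y cy <-]; rewrite /chart_rep /= coordK.
by rewrite diff_val.
Qed.

(** The chain rule for [id \o id], read through the two charts. *)
Lemma chart_diffK M (c c' : chart R d M) x a : atlas c -> atlas c' ->
  dom c x -> dom c' x -> chart_diff c c' id x (chart_diff c' c id x a) = a.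
Proof.
move=> Ac Ac' cx cx'.
by rewrite -(chart_diff_comp a (@diff_map_id _ _ M) (@diff_map_id _ _ M) Ac' Ac Ac')
  // chart_diff_id.
Qed.

Lemma chart_vectorE M (c : chart R d M) x a :
  chart_vector c x a = chart_diff c (chart_at x) id x a.
Proof. by []. Qed.

(** Acts on plain row vectors, so that base points can be rewritten without transporting tangent
    vectors. *)
Definition tangent_diff M N (h : M -> N) (x : M) : 'rV[R]_d -> 'rV[R]_d :=
  chart_diff (chart_at x) (chart_at (h x)) h x.

Lemma tmapE M N (h : M -> N) x (u : tangent x) : tmap h x u = tangent_diff h x u.
Proof. exact: lfunE. Qed.

Lemma tangent_diff_id M (x : M) u : tangent_diff id x u = u.
Proof. exact/chart_diff_id/chart_at_dom. Qed.

Lemma tangent_diff_comp M N Q (h : M -> N) (h' : N -> Q) x u :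
  diff_map h -> diff_map h' ->
  tangent_diff (h' \o h) x u = tangent_diff h' (h x) (tangent_diff h x u).
Proof.
by move=> hd hd'; apply: chart_diff_comp => //;
  first [exact: chart_at_atlas | exact: chart_at_dom].
Qed.

(** A chart vector is the differential of [id] from [c] to the preferred chart, so both sides are
    the differential of [h] read from [c] to [chart_at (h x)]. *)
Lemma tangent_diff_chart_vector M N (h : M -> N) c c' x a : diff_map h ->
  atlas c -> atlas c' -> dom c x -> dom c' (h x) ->
  tangent_diff h x (chart_vector c x a) =
  chart_vector c' (h x) (chart_diff c c' h x a).
Proof.
move=> hd Ac Ac' cx chx; rewrite !chart_vectorE /tangent_diff.
rewrite -(chart_diff_comp a (@diff_map_id _ _ M) hd Ac) //;
  [| exact: chart_at_atlas | exact: chart_at_atlas | exact: chart_at_dom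
   | exact: chart_at_dom].
rewrite -(chart_diff_comp a hd (@diff_map_id _ _ N) Ac Ac') //;
  [exact: chart_at_atlas | exact: chart_at_dom].
Qed.

Lemma chart_vectorK M (c : chart R d M) x u : atlas c -> dom c x ->
  chart_vector c x (chart_diff (chart_at x) c id x u) = u.
Proof.
by move=> Ac cx; apply: chart_diffK => //;
  first [exact: chart_at_atlas | exact: chart_at_dom].
Qed.

Lemma chart_vector_eq0 M (c : chart R d M) x a : atlas c -> dom c x ->
  chart_vector c x a = 0 -> a = 0.
Proof.
move=> Ac cx a0; rewrite -[a](@chart_diffK M (chart_at x) c x) //;
  [|exact: chart_at_atlas | exact: chart_at_dom].
by rewrite -chart_vectorE a0 /chart_diff linear0.
Qed.

End ChartDiff.

(** * The abstract estimate for dominated families *)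

Lemma expR_decay (R : realType) (alpha b : R) : 0 < alpha ->
  (* With [m] at least [b / alpha], one has [b <= m * alpha < 1 + m * alpha <= expR (m * alpha)]. *)
  exists m : nat, b * expR (- (m%:R * alpha)) <= 1.
Proof.
move=> a0; exists (Num.bound `|b / alpha|).
set m := Num.bound _.
have bm : b <= m%:R * alpha.
  rewrite -ler_pdivrMr //; apply: ltW; apply: le_lt_trans (ler_norm _) _.
  exact: archi_boundP (normr_ge0 _).
rewrite expRN ler_pdivrMr ?expR_gt0 // mul1r.
by have := expR_ge1Dx (m%:R * alpha); lra.
Qed.

(** Here [s] stands for a base point with a time, and [N s m] for the norm [m] iterations later.
    Domination is in product form to avoid division. The number [m] and all constants are chosen
    before [s], which makes the final bound uniform. *)
Lemma dominated_sum_bound (R : realType) (S : Type) (V : zmodType)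
    (N : S -> nat -> V -> R) (k : nat) (E : 'I_k -> S -> V -> Prop)
    (C alpha : R) :
  (forall s m u, 0 <= N s m u) -> (forall s m, N s m 0 = 0) ->
  (forall s m u, N s m (- u) = N s m u) ->
  (forall s m u v, N s m (u + v) <= N s m u + N s m v) ->
  (forall m, exists L, forall s u,
     N s m u <= L * N s 0%N u /\ N s 0%N u <= L * N s m u) ->
  0 <= C -> 0 < alpha ->
  (forall i j : 'I_k, (i < j)%N -> forall s u v m, E i s u -> E j s v ->
     N s m u * N s 0%N v <=
     C * expR (- (m%:R * alpha)) * (N s 0%N u * N s m v)) ->
  exists2 K, 0 <= K & forall s (w : 'I_k -> V), (forall l, E l s (w l)) ->
    \sum_l N s 0%N (w l) <= K * N s 0%N (\sum_l w l).
Proof.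
move=> Nge0 N0 NN ND NL C0 a0 dom.
suff H p : (p <= k)%N -> exists2 K, 0 <= K & forall s (w : 'I_k -> V),
    (forall l, E l s (w l)) ->
    \sum_(l < k | (l < p)%N) N s 0%N (w l) <=
    K * N s 0%N (\sum_(l < k | (l < p)%N) w l).
  have [K K0 HK] := H k (leqnn k); exists K => // s w Ew; have := HK s w Ew.
  have lk : (fun l : 'I_k => (l < k)%N) =1 xpredT by move=> l; rewrite ltn_ord.
  by rewrite (eq_bigl _ _ lk) (eq_bigl _ (fun l => w l) lk).
elim: p => [_|p IH pk].
  by exists 0 => // s w _; rewrite !big_pred0 // mul0r.
have [K K0 HK] := IH (ltnW pk).
(* The factor 4 is 2 from the case [N_0 W <= 2 * N_0 v] times 2 for the wanted
   [N_m W <= N_m v / 2]. *)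
have [m Hm] := expR_decay (4 * (C * K)) a0.
have [L L0 HL] : exists2 L, 0 <= L & forall s u,
    N s m u <= L * N s 0%N u /\ N s 0%N u <= L * N s m u.
  have [L HL] := NL m; exists `|L| => // s u; have [L1 L2] := HL s u.
  by split; [apply: le_trans L1 _ | apply: le_trans L2 _];
    rewrite ler_wpM2r ?ler_norm.
(* With [t = N_0 (v + W)] and [b = N_0 v], the sum is at most [K * (t + b) + b], and below
   [b <= (2 * L ^+ 2 + 1) * t]. *)
exists (K + (K + 1) * (2 * L ^+ 2 + 1)).
  by have := sqr_ge0 L; nra.
move=> s w Ew.
pose i := Ordinal pk.
have split_last (T : zmodType) (F : 'I_k -> T) :
    \sum_(l < k | (l < p.+1)%N) F l = F i + \sum_(l < k | (l < p)%N) F l.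
  rewrite (bigD1 i) ?ltnSn //=; congr (_ + _); apply: eq_bigl => l.
  by rewrite ltnS [RHS]ltn_neqAle andbC.
rewrite !split_last.
have {HK} := HK s w Ew.
set S0 := \sum_(l < k | _) N s 0%N _; set W := \sum_(l < k | _) w l => HS.
set v := w i; set q := C * expR (- (m%:R * alpha)) in Hm *.
have q0 : 0 <= q by rewrite mulr_ge0 // expR_ge0.
have Hq : 4 * (q * K) <= 1 by apply: le_trans Hm; rewrite /q; lra.
(* Domination of each earlier component against [v], summed; the induction hypothesis then replaces
   the sum of norms by [N_0 W]. *)
have HW : N s m W * N s 0%N v <= q * (K * N s 0%N W) * N s m v.
  have NW : N s m W <= \sum_(l < k | (l < p)%N) N s m (w l).
    rewrite /W; elim/big_rec2: _ => [|l x y _ xy]; first by rewrite N0.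
    by apply: le_trans (ND _ _ _ _) _; rewrite lerD2l.
  apply: le_trans (ler_wpM2r (Nge0 _ _ _) NW) _.
  apply: (@le_trans _ _ (q * S0 * N s m v)); last first.
    by rewrite ler_wpM2r // ler_wpM2l.
  rewrite mulr_suml /S0 mulr_sumr mulr_suml; apply: ler_sum => l lp.
  by rewrite -mulrA; apply: (dom l i).
have t0 := Nge0 s 0%N (v + W); have b0 := Nge0 s 0%N v; have a0' := Nge0 s 0%N W.
have Wt : N s 0%N W <= N s 0%N (v + W) + N s 0%N v.
  by rewrite -{1}[W](addKr v) addrC -(NN s 0%N v); exact: ND.
suff bt : N s 0%N v <= (2 * L ^+ 2 + 1) * N s 0%N (v + W).
  have : K * N s 0%N W <= K * (N s 0%N (v + W) + N s 0%N v) by rewrite ler_wpM2l.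
  have : (K + 1) * N s 0%N v <= (K + 1) * ((2 * L ^+ 2 + 1) * N s 0%N (v + W)).
    by rewrite ler_wpM2l //; lra.
  by move: HS; lra.
have L2 := sqr_ge0 L.
have L2t : 0 <= L ^+ 2 * N s 0%N (v + W) by rewrite mulr_ge0.
(* If [N_0 W > 2 * N_0 v], the triangle inequality [Wt] already gives [N_0 v < N_0 (v + W)]. *)
have [ab|ba] := lerP (N s 0%N W) (2 * N s 0%N v); last by lra.
have [bp|] := ltrP 0 (N s 0%N v); last by lra.
have B0 := Nge0 s m v.
have half : N s m W <= N s m v / 2.
  rewrite -(ler_pM2r bp); apply: le_trans HW _.
  have : q * K * N s 0%N W <= q * K * (2 * N s 0%N v).
    by rewrite ler_wpM2l // mulr_ge0.
  move=> /(ler_wpM2r B0).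
  have : 4 * (q * K) * (N s 0%N v * N s m v) <= 1 * (N s 0%N v * N s m v).
    by rewrite ler_wpM2r // mulr_ge0.
  by lra.
(* Absorbing [N_m W <= N_m v / 2] leaves [N_m v <= 2 * N_m (v + W)]; passing between times 0 and [m]
   costs a factor [L] on each side. *)
have vt : N s m v <= N s m (v + W) + N s m W.
  by rewrite -{1}[v](addrK W) -(NN s m W); exact: ND.
have [_ L1] := HL s v; have [L3 _] := HL s (v + W).
have : L * N s m v <= L * (2 * (L * N s 0%N (v + W))) by rewrite ler_wpM2l //; lra.
by move: L1; rewrite expr2; lra.
Qed.

(** * The norm of an inner product on the tangent spaces *)

Section InnerProduct.
Context (R : realType) (d : nat) (M : manifold R d) (g : metric M).

(** Takes row vectors, to which [tangent x] unfolds, so that the type of a vector does not mention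
    its base point. *)
Definition tinner (x : M) (u v : 'rV[R]_d) : R := @inner R d M g x u v.
Definition tlength (x : M) (u : 'rV[R]_d) : R := Num.sqrt (tinner x u u).

Lemma tnormE (x : M) (u : tangent x) : tnorm g u = tlength x u.
Proof. by []. Qed.

Lemma tinnerC x u v : tinner x u v = tinner x v u.
Proof. exact: innerC. Qed.

Lemma tinnerP x a u v w :
  tinner x (a *: u + v) w = a * tinner x u w + tinner x v w.
Proof. exact: inner_linear. Qed.

Lemma tinner_gt0 x u : u != 0 -> 0 < tinner x u u.
Proof. exact: inner_gt0. Qed.

Lemma tinner0l x v : tinner x 0 v = 0.
Proof. by have := tinnerP x (-1) 0 0 v; rewrite scaler0 addr0; lra. Qed.

Lemma tinnerZl x a u v : tinner x (a *: u) v = a * tinner x u v.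
Proof. by rewrite -[a *: u]addr0 tinnerP tinner0l addr0. Qed.

Lemma tinnerDl x u v w : tinner x (u + v) w = tinner x u w + tinner x v w.
Proof. by rewrite -[u in LHS]scale1r tinnerP mul1r. Qed.

Lemma tinner_ge0 x u : 0 <= tinner x u u.
Proof. by have [->|/tinner_gt0/ltW//] := eqVneq u 0; rewrite tinner0l. Qed.

Lemma tinnerZr x a u v : tinner x u (a *: v) = a * tinner x u v.
Proof. by rewrite tinnerC tinnerZl tinnerC. Qed.

Lemma tinnerDr x u v w : tinner x u (v + w) = tinner x u v + tinner x u w.
Proof. by rewrite ![tinner x u _]tinnerC tinnerDl. Qed.

Lemma tinner_cauchy_schwarz x u v :
  tinner x u v ^+ 2 <= tinner x u u * tinner x v v.
Proof.
have [->|v0] := eqVneq v 0.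
  by rewrite tinnerC !tinner0l expr0n mulr0.
have vp := tinner_gt0 x v0.
(* For [a = <u,u>], [b = <u,v>], [c = <v,v>], the vector [c u - b v] has square norm
   [c * (a * c - b ^+ 2)]. *)
have := tinner_ge0 x (tinner x v v *: u + (- tinner x u v) *: v).
rewrite !(tinnerDl, tinnerDr, tinnerZl, tinnerZr) (tinnerC x v u).
set a := tinner x u u; set b := tinner x u v; set c := tinner x v v in vp *.
move=> H; have : 0 <= c * (a * c - b ^+ 2) by move: H; lra.
by rewrite pmulr_rge0 // subr_ge0.
Qed.

Lemma tlength_ge0 x u : 0 <= tlength x u.
Proof. exact: sqrtr_ge0. Qed.

Lemma tlength0 x : tlength x 0 = 0.
Proof. by rewrite /tlength tinner0l sqrtr0. Qed.

Lemma sqr_tlength x u : tlength x u ^+ 2 = tinner x u u.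
Proof. by rewrite sqr_sqrtr // tinner_ge0. Qed.

Lemma tlengthN x u : tlength x (- u) = tlength x u.
Proof. by rewrite /tlength -scaleN1r tinnerZl tinnerZr !mulN1r opprK. Qed.

Lemma tlengthD x u v : tlength x (u + v) <= tlength x u + tlength x v.
Proof.
rewrite -ler_sqr ?nnegrE ?addr_ge0 ?tlength_ge0 // sqrrD !sqr_tlength.
rewrite !(tinnerDl, tinnerDr) (tinnerC x v u).
suff : tinner x u v <= tlength x u * tlength x v by lra.
apply: le_trans (ler_norm _) _.
by rewrite -sqrtr_sqr -sqrtrM ?tinner_ge0 // ler_wsqrtr // tinner_cauchy_schwarz.
Qed.

Lemma tinner_suml x (I : Type) (r : seq I) (F : I -> 'rV[R]_d) v :
  tinner x (\sum_(i <- r) F i) v = \sum_(i <- r) tinner x (F i) v.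
Proof.
by elim/big_rec2: _ => [|i y z _ <-]; rewrite ?tinner0l // tinnerDl.
Qed.

Lemma tinner_sumr x (I : Type) (r : seq I) (F : I -> 'rV[R]_d) v :
  tinner x v (\sum_(i <- r) F i) = \sum_(i <- r) tinner x v (F i).
Proof. by rewrite tinnerC tinner_suml; apply: eq_bigr => i _; exact: tinnerC. Qed.

End InnerProduct.

(** * Matrix norms, compactness and quadratic forms *)

Lemma rV_coord_le_norm (R : realDomainType) d (v : 'rV[R]_d) i : `|v 0 i| <= mx_norm v.
Proof.
rewrite mx_normrE; apply/bigmax_geP; right => /=.
by exists (ord0, i).
Qed.

Lemma rV_norm_le (R : realDomainType) d (v : 'rV[R]_d) r :
  0 <= r -> (forall i, `|v 0 i| <= r) -> mx_norm v <= r.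
Proof.
move=> r0 vr; rewrite mx_normrE; apply/bigmax_leP; split=> // -[i j] _ /=.
by rewrite ord1.
Qed.

Lemma mulmx_norm_le (R : realType) d (v : 'rV[R]_d) (A : 'M[R]_d) :
  `|v *m A| <= `|v| * \sum_i \sum_j `|A i j|.
Proof.
apply: rV_norm_le => [|j].
  by rewrite mulr_ge0 // sumr_ge0 // => i _; exact: sumr_ge0.
rewrite mxE; apply: le_trans (ler_norm_sum _ _ _) _.
rewrite mulr_sumr; apply: ler_sum => i _; rewrite normrM ler_pM //.
  exact: rV_coord_le_norm.
by rewrite (bigD1 j) //= lerDl sumr_ge0.
Qed.

(** Monotonicity turns a local bound into one valid for all large constants near the point;
    compactness then exchanges [near +oo] with the quantifier over [K]. *)
Lemma compact_uniform_bound (R : realType) (T : topologicalType) (K : set T)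
    (P : T -> R -> Prop) : compact K ->
  (forall x r s, r <= s -> P x r -> P x s) ->
  (forall x, K x -> exists r, \forall y \near x, P y r) ->
  exists r, forall x, K x -> P x r.
Proof.
move=> /compact_near_coveringP cK Pmono Ploc.
have : \forall r \near +oo, K `<=` (fun x => P x r).
  apply: cK => x Kx; have [r Pr] := Ploc x Kx.
  exists ([set y | P y r], [set s | r <= s]) => /=.
    by split=> //; apply: nbhs_pinfty_ge; rewrite num_real.
  by move=> [y s] /= [Pyr rs]; exact: Pmono Pyr.
by move=> /filter_ex[r Kr]; exists r.
Qed.

Lemma cvg_sumr (R : realType) (T I : Type) (F : set_system T)
    {FF : Filter F} (r : seq I)
    (f : I -> T -> R) (l : I -> R) :
  (forall i, f i x @[x --> F] --> l i) ->
  \sum_(i <- r) f i x @[x --> F] --> \sum_(i <- r) l i.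
Proof. by move=> fl; apply: cvg_big => // x; exact: add_continuous. Qed.

Section QuadraticForm.
Context (R : realType) (d : nat).
Implicit Types (A B : 'M[R]_d) (a : 'rV[R]_d).

Definition quad A a : R := \sum_i \sum_j a 0 i * a 0 j * A i j.

Definition mx_size A : R := \sum_i \sum_j `|A i j|.

Lemma mx_size_ge0 A : 0 <= mx_size A.
Proof. by rewrite sumr_ge0 // => i _; rewrite sumr_ge0. Qed.

Lemma mx_sizeD A B : mx_size (A + B) <= mx_size A + mx_size B.
Proof.
rewrite /mx_size -big_split; apply: ler_sum => i _; rewrite -big_split.
by apply: ler_sum => j _; rewrite mxE ler_normD.
Qed.

Lemma mx_size_le A B : mx_size A <= mx_size (A - B) + mx_size B.
Proof. by rewrite -{1}(subrK B A) mx_sizeD. Qed.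

Lemma quadB A B a : quad (A - B) a = quad A a - quad B a.
Proof.
rewrite /quad -sumrB; apply: eq_bigr => i _; rewrite -sumrB.
by apply: eq_bigr => j _; rewrite !mxE mulrBr.
Qed.

Lemma quadZ A t a : quad A (t *: a) = t ^+ 2 * quad A a.
Proof.
rewrite /quad mulr_sumr; apply: eq_bigr => i _; rewrite mulr_sumr.
by apply: eq_bigr => j _; rewrite !mxE; ring.
Qed.

Lemma quad_norm_le A a : `|quad A a| <= `|a| ^+ 2 * mx_size A.
Proof.
rewrite /quad /mx_size mulr_sumr; apply: le_trans (ler_norm_sum _ _ _) _.
apply: ler_sum => i _; rewrite mulr_sumr; apply: le_trans (ler_norm_sum _ _ _) _.
apply: ler_sum => j _; rewrite !normrM expr2 ler_wpM2r // ler_pM //;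
  exact: rV_coord_le_norm.
Qed.

Lemma quad_continuous A : continuous (quad A).
Proof.
move=> a; have Fa := nbhs_filter a.
apply: (@cvg_sumr R _ _ _ Fa) => i; apply: (@cvg_sumr R _ _ _ Fa) => j.
by apply: cvgMr_tmp; apply: cvgM; exact: coord_continuous.
Qed.

(** On the compact unit sphere a continuous positive function is bounded away from 0; homogeneity of
    degree 2 extends the bound to all vectors. *)
Lemma quad_lower_bound A : (forall a, a != 0 -> 0 < quad A a) ->
  exists2 r, 0 < r & forall a, `|a| ^+ 2 <= r * quad A a.
Proof.
move=> Apos.
(* The conjunct [0 <= quad A a] makes the predicate monotone in [r]. *)
have [|a r s rs [q0 q1]|a a1|r Hr] :=
  @compact_uniform_bound R _ [set a : 'rV[R]_d | `|a| = 1]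
    (fun a r => 0 <= quad A a /\ 1 <= r * quad A a).
- apply: bounded_closed_compact.
    by exists 1; split; [exact: num_real | move=> s s1 a /= ->; exact: ltW].
  apply: (@preimage_closed _ _ (fun a : 'rV[R]_d => `|a|) [set 1]).
    by move=> a _; exact: norm_continuous.
  exact: closed_eq.
- by split=> //; apply: le_trans q1 _; rewrite ler_wpM2r.
- have qa : 0 < quad A a.
    by apply: Apos; apply: contra_eq_neq a1 => ->; rewrite normr0 eq_sym oner_eq0.
  exists (2 / quad A a).
  have : \forall b \near a, quad A a / 2 < quad A b.
    by apply: (cvgr_gt _ (@quad_continuous A a)); lra.
  apply: filterS => b qb; split; first by lra.
  by rewrite mulrAC ler_pdivlMr //; lra.
(* Compactness gives no sign for [r]; for [d = 0] the sphere is empty. *)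
exists (Num.max r 1); first by rewrite lt_max ltr01 orbT.
move=> a; have [->|a0] := eqVneq a 0.
  rewrite normr0 expr0n /= mulr_ge0 //; first by rewrite le_max ler01 orbT.
  by have := quadZ A 0 0; rewrite scaler0 expr0n mul0r => ->.
have na : 0 < `|a| by rewrite normr_gt0.
have [q0 q1] : 0 <= quad A (`|a|^-1 *: a) /\ 1 <= r * quad A (`|a|^-1 *: a).
  by apply: Hr; rewrite /= normrZ normfV normr_id mulVf ?gt_eqF.
move: q1; rewrite quadZ exprVn mulrCA ler_pdivlMl ?exprn_gt0 // mulr1 => q1.
apply: le_trans q1 _; rewrite ler_wpM2r ?le_max ?lexx //.
exact/ltW/Apos.
Qed.

Lemma near_mx_size (T : topologicalType) (A : T -> 'M[R]_d) (x : T) (e : R) :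
  (forall i j, {for x, continuous (fun y => A y i j)}) -> 0 < e ->
  \forall y \near x, mx_size (A y - A x) < e.
Proof.
move=> cA e0.
have cv : mx_size (A y - A x) @[y --> x] --> 0.
  rewrite -(_ : mx_size (A x - A x) = 0); last first.
    by rewrite /mx_size big1 // => i _; rewrite big1 // => j _; rewrite !mxE subrr normr0.
  apply: cvg_sumr => i; apply: cvg_sumr => j; apply: cvg_norm.
  rewrite [X in X @ _](_ : _ = fun y => A y i j - A x i j); last first.
    by apply/funext => y; rewrite !mxE.
  by rewrite !mxE; apply: cvgB; [exact: cA | exact: cvg_cst].
exact: cvgr_lt cv _ e0.
Qed.

End QuadraticForm.

(** Perturbing a definite form by at most half of its lower bound [n / r] leaves the other half. *)
Lemma half_lower_bound (R : realFieldType) (r q q0 n : R) :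
  - (n * (2 * r)^-1) <= q - q0 -> n <= r * q0 -> 0 < r -> n <= 2 * r * q.
Proof.
move=> qq nq r0; have : r * - (n * (2 * r)^-1) <= r * (q - q0).
  by rewrite ler_wpM2l // ltW.
have -> : r * - (n * (2 * r)^-1) = - (n / 2) by field; rewrite gt_eqF.
by lra.
Qed.

(** * Uniform bounds for the derivative of a C^1 map *)

Section ChartBounds.
Context (R : realType) (d : nat).
Implicit Types M N : manifold R d.

Lemma chart_diff_sum M N (c : chart R d M) (c' : chart R d N) h x a :
  chart_diff c c' h x a = \sum_i a 0 i *: chart_diff c c' h x (delta_mx 0 i).
Proof.
rewrite /chart_diff {1}(row_sum_delta a) linear_sum.
by apply: eq_bigr => i _; rewrite linearZ.
Qed.

Definition gram M (g : metric M) (c : chart R d M) (x : M) : 'M[R]_d :=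
  \matrix_(i, j) tinner g x (chart_vector c x (delta_mx 0 i))
                            (chart_vector c x (delta_mx 0 j)).

Lemma tinner_chart_vector M (g : metric M) c x a :
  tinner g x (chart_vector c x a) (chart_vector c x a) = quad (gram g c x) a.
Proof.
rewrite !chart_vectorE chart_diff_sum tinner_suml; apply: eq_bigr => i _.
rewrite tinner_sumr; apply: eq_bigr => j _.
by rewrite tinnerZl tinnerZr mxE mulrA.
Qed.

(** The Gram matrix is continuous and definite at [x0]. Nearby it differs too little to lose
    definiteness, so one constant compares the metric with the coordinate norm. *)
Lemma chart_metric_bound M (g : metric M) c x0 : atlas c -> dom c x0 ->
  exists2 A, 0 <= A & \forall x \near x0, forall a,
    tlength g x (chart_vector c x a) <= A * `|a| /\
    `|a| <= A * tlength g x (chart_vector c x a).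
Proof.
move=> Ac cx0.
have [a a0|r r0 Hr] := @quad_lower_bound R d (gram g c x0).
  rewrite -tinner_chart_vector; apply: tinner_gt0.
  by apply: contra_neq a0; exact: chart_vector_eq0.
have e0 : 0 < (2 * r)^-1 by rewrite invr_gt0 mulr_gt0.
have cG i j : {for x0, continuous (fun x => gram g c x i j)}.
  have := @inner_continuous _ _ _ g c Ac (delta_mx 0 i) (delta_mx 0 j).
  rewrite continuous_open_subspace; last exact: dom_open.
  move=> /(_ x0); rewrite inE => /(_ cx0).
  by rewrite (_ : (fun x => gram g c x i j) = fun x =>
    inner g (chart_vector c x (delta_mx 0 i)) (chart_vector c x (delta_mx 0 j)))
    //; apply/funext => x; rewrite mxE.
have [S S0 SE] : exists2 S, 0 <= S & mx_size (gram g c x0) = S.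
  by exists (mx_size (gram g c x0)) => //; exact: mx_size_ge0.
(* The estimates are on squares: [B] bounds the size of nearby Gram matrices, [2 * r] is the
   lower-bound constant, and the summand 1 gives [B <= B ^+ 2]. *)
pose B := 1 + 2 * r + S + (2 * r)^-1; have B1 : 1 <= B by rewrite /B; lra.
have B2 : B <= B ^+ 2 by nra.
have B3 : 2 * r <= B ^+ 2 by apply: le_trans B2; rewrite /B; lra.
have BB : 0 <= B by lra.
exists B; first by lra.
have := near_mx_size cG e0; apply: filterS => x Gx a.
have qx : `|quad (gram g c x) a - quad (gram g c x0) a| <= `|a| ^+ 2 * (2 * r)^-1.
  rewrite -quadB; apply: le_trans (quad_norm_le _ _) _.
  by rewrite ler_wpM2l ?sqr_ge0 // ltW.
have n0 := sqr_ge0 `|a|.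
have Sx : mx_size (gram g c x) <= B.
  apply: le_trans (mx_size_le _ (gram g c x0)) _; rewrite SE.
  by apply: le_trans (lerD (ltW Gx) (lexx S)) _; rewrite /B; lra.
split.
- rewrite -ler_sqr ?nnegrE ?mulr_ge0 ?tlength_ge0 //.
  rewrite sqr_tlength tinner_chart_vector exprMn.
  apply: le_trans (ler_norm _) _; apply: le_trans (quad_norm_le _ _) _.
  by rewrite mulrC ler_wpM2r // (le_trans Sx).
- rewrite -ler_sqr ?nnegrE ?mulr_ge0 ?tlength_ge0 //.
  rewrite exprMn sqr_tlength tinner_chart_vector.
  have q0 : 0 <= quad (gram g c x) a by rewrite -tinner_chart_vector tinner_ge0.
  suff H : `|a| ^+ 2 <= 2 * r * quad (gram g c x) a.
    by apply: le_trans H _; rewrite ler_wpM2r.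
  move: (Hr a) qx r0; rewrite ler_norml => Hra /andP[qx _]; move: qx Hra.
  exact: half_lower_bound.
Qed.

(** Preferred charts may jump from point to point, so near [x0] the charts chosen at [x0] and [h x0]
    are kept fixed. There the Jacobian is continuous, hence locally bounded, and compactness makes
    the bound global. *)
Lemma C1_map_bound M N (g : metric M) (g' : metric N) (h : M -> N) :
  compact [set: M] -> C1_map h ->
  exists L, forall x u,
    tlength g' (h x) (tangent_diff h x u) <= L * tlength g x u.
Proof.
move=> cM hC1; have hd := C1_diff_map hC1.
have [x r s rs H u|x0 _|L HL] := @compact_uniform_bound R M setT (fun x L =>
    forall u, tlength g' (h x) (tangent_diff h x u) <= L * tlength g x u) cM.
- by apply: le_trans (H u) _; rewrite ler_wpM2r // tlength_ge0.
- pose c := chart_at x0; pose c' := chart_at (h x0).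
  have Ac : atlas c by exact: chart_at_atlas.
  have Ac' : atlas c' by exact: chart_at_atlas.
  have cx0 : dom c x0 by exact: chart_at_dom.
  have cx0' : dom c' (h x0) by exact: chart_at_dom.
  have [A A0 HA] := chart_metric_bound g Ac cx0.
  have [A' A0' HA'] := chart_metric_bound g' Ac' cx0'.
  pose J x := jacobian (Defs.coord c' \o h \o param c) (Defs.coord c x).
  have cJ i j : {for x0, continuous (fun x => J x i j)}.
    have [_ Jc] := hC1.2 _ _ Ac Ac' (Defs.coord c x0)
      (ex_intro2 _ _ x0 (conj cx0 cx0') erefl).
    apply: (@continuous_comp _ _ _ J (fun B : 'M[R]_d => B i j)).
      exact: (continuous_comp (coord_continuous_at cx0) Jc).
    exact: matrix_normedtype.coord_continuous.
  pose B := mx_size (J x0) + 1.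
  have B0 : 0 <= B by rewrite /B addr_ge0 // mx_size_ge0.
  have Jd x a : `|chart_diff c c' h x a| <= `|a| * mx_size (J x).
    rewrite (_ : chart_diff c c' h x a = a *m J x); first exact: mulmx_norm_le.
    by rewrite mul_rV_lin1.
  (* Metric comparison in the target, Jacobian bound, metric comparison in the source. *)
  exists (A' * B * A).
  have near_h : \forall x \near x0, dom c' (h x) /\ forall b,
      tlength g' (h x) (chart_vector c' (h x) b) <= A' * `|b|.
    have : \forall y \near h x0, dom c' y /\ forall b,
        tlength g' y (chart_vector c' y b) <= A' * `|b|.
      have := near_dom cx0'; move: HA'; apply: filterS2 => y H dy.
      by split=> // b; have [] := H b.
    exact: (hC1.1 x0).
  have near_J := near_mx_size cJ (@ltr01 R).
  apply: filterS (filterI (filterI HA near_h) (filterI (near_dom cx0) near_J)).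
  move=> x [[HAx [hx HA'']] [cx HB]] u.
  have [a ->] : exists a, u = chart_vector c x a.
    by exists (chart_diff (chart_at x) c id x u); rewrite chart_vectorK.
  rewrite (@tangent_diff_chart_vector _ _ _ _ _ c c') //.
  have [_ H1] := HAx a; apply: le_trans (HA'' _) _.
  rewrite -!mulrA ler_wpM2l //; apply: le_trans (Jd _ _) _.
  rewrite mulrC; apply: ler_pM => //; first exact: mx_size_ge0.
  apply: le_trans (mx_size_le _ (J x0)) _.
  by rewrite addrC lerD2l ltW.
by exists L => x; exact: HL.
Qed.

End ChartBounds.

(** * Sums of projectors and repeated growth *)

Lemma oblique_projector_sum (K : fieldType) (V : vectType K) (k : nat)
    (E : 'I_k -> {vspace V}) (P : 'I_k -> 'End(V)) :
  (\sum_i E i)%VS = fullv ->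
  (forall i, [/\ (P i \o P i)%VF = P i, limg (P i) = E i
    & lker (P i) = (\sum_(j < k | j != i) E j)%VS]) ->
  forall w, \sum_i P i w = w.
Proof.
move=> Efull HP w.
have /memv_sumP[vs vsE ->] : w \in (\sum_i E i)%VS by rewrite Efull memvf.
apply: eq_bigr => i _; have [PP PE PK] := HP i.
rewrite linear_sum (bigD1 i) //= big1 ?addr0 => [|j ji].
  have := vsE i isT; rewrite -PE => /memv_imgP[z _ ->].
  (* By idempotence [P i] fixes its range [E i]; the other components lie in its kernel. *)
  by rewrite -[LHS](comp_lfunE (P i) (P i)) PP.
apply/eqP; rewrite -memv_ker PK.
exact: subvP (sumv_sup j ji (subvv _)) _ (vsE j isT).
Qed.

Lemma iterated_growth (R : realFieldType) (S V : Type) (N : S -> nat -> V -> R)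
    (L : R) : (forall s m u, 0 <= N s m u) -> 0 <= L ->
  (forall s m u, N s m.+1 u <= L * N s m u /\ N s m u <= L * N s m.+1 u) ->
  forall m, exists L', forall s u,
    N s m u <= L' * N s 0%N u /\ N s 0%N u <= L' * N s m u.
Proof.
move=> N0 L0 step m; exists (L ^+ m) => s u.
elim: m => [|m [H1 H2]]; first by rewrite expr0 mul1r.
have [S1 S2] := step s m u; split.
  by apply: le_trans S1 _; rewrite exprS -mulrA ler_wpM2l.
by apply: le_trans H2 _; rewrite exprSr -mulrA ler_wpM2l // exprn_ge0.
Qed.

(** * Integer iterates and norms along an orbit *)

Section Iterates.
Context (R : realType) (d : nat) (M : manifold R d) (f : diffeo M).

Lemma iterz_succ n : iterz f (n + 1) = f \o iterz f n.
Proof.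
apply/funext => x; case: n => [p|p]; first by rewrite -PoszD addn1.
(* [Negz p] is [-(p + 1)], so [p = 0] is the passage from -1 to 0. *)
case: p => [|p]; first exact: esym (bwdK f x).
have -> : Negz p.+1 + 1 = Negz p by rewrite !NegzE -(addn1 p.+1) PoszD opprD addrNK.
by rewrite /= bwdK.
Qed.

(** Lets the derivative bound of [bwd f] control the norm at time [n] by the norm at time
    [n + 1]. *)
Lemma iterz_pred n : iterz f n = bwd f \o iterz f (n + 1).
Proof. by apply/funext => x; rewrite iterz_succ /= fwdK. Qed.

Lemma iterzK n : cancel (iterz f n) (iterz f (- n)).
Proof.
have iterK (g h : M -> M) p : cancel h g -> cancel (iter p h) (iter p g).
  by move=> hK x; elim: p x => // p IH x; rewrite iterSr [X in g X]iterS hK IH.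
case: n => [[|p]|p] x //.
- exact: iterK (fwdK f) x.
- exact: iterK (bwdK f) x.
Qed.

Lemma iterz_diff_map n : diff_map (iterz f n).
Proof.
have iter_diff (h : M -> M) p : C1_map h -> diff_map (iter p h).
  move=> /C1_diff_map hd; elim: p => [|p IH]; first exact: diff_map_id.
  exact: diff_map_comp IH hd.
by case: n => p; apply: iter_diff; [exact: fwd_C1 | exact: bwd_C1].
Qed.

Lemma tangent_diff_iterzK n x u :
  tangent_diff (iterz f n) x (tangent_diff (iterz f (- n)) (iterz f n x) u) = u.
Proof.
set y := iterz f n x.
have xE : iterz f (- n) y = x by exact: iterzK.
have yK : iterz f n \o iterz f (- n) = id.
  by apply/funext => z /=; have := iterzK (- n) z; rewrite opprK.
(* The outer base point becomes [f^{-n} y], so that the chain rule for [f^n \o f^{-n} = id] applies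
   at [y]. *)
rewrite -[in LHS]xE -tangent_diff_comp; [|exact: iterz_diff_map..].
by rewrite yK tangent_diff_id.
Qed.

Variable g : metric M.

(* [s = (x, n)] stands for the base point [f^n x] on the orbit of [x]. *)
Definition orbit_norm (s : M * int) (m : nat) (u : 'rV[R]_d) : R :=
  tlength g (iterz f (s.2 + m%:Z) s.1)
    (tangent_diff (iterz f (s.2 + m%:Z)) s.1 u).

Lemma tnorm_DpowE n x (u : tangent x) :
  tnorm g (Dpow f n x u) = tlength g (iterz f n x) (tangent_diff (iterz f n) x u).
Proof. by rewrite tnormE /Dpow tmapE. Qed.

Lemma orbit_normE (s : M * int) m (u : tangent s.1) :
  orbit_norm s m u = tnorm g (Dpow f (s.2 + m%:Z) s.1 u).
Proof. by rewrite tnorm_DpowE. Qed.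

Lemma orbit_norm0E (s : M * int) (u : tangent s.1) :
  orbit_norm s 0 u = tnorm g (Dpow f s.2 s.1 u).
Proof. by rewrite tnorm_DpowE /orbit_norm addr0. Qed.

Lemma orbit_norm_growth : compact [set: M] -> forall m, exists L, forall s u,
  orbit_norm s m u <= L * orbit_norm s 0%N u /\
  orbit_norm s 0%N u <= L * orbit_norm s m u.
Proof.
move=> cM.
have [Lf HLf] := C1_map_bound g g cM (fwd_C1 f).
have [Lb HLb] := C1_map_bound g g cM (bwd_C1 f).
(* The two bounds carry no sign; this sum is nonnegative and serves both directions. *)
have L0 : 0 <= `|Lf| + `|Lb| by rewrite addr_ge0.
have step s m u : orbit_norm s m.+1 u <= (`|Lf| + `|Lb|) * orbit_norm s m u /\
    orbit_norm s m u <= (`|Lf| + `|Lb|) * orbit_norm s m.+1 u.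
  rewrite /orbit_norm -addn1 PoszD addrA; move: (s.2 + m%:Z) => n.
  split.
  - rewrite iterz_succ tangent_diff_comp;
      [|exact: iterz_diff_map | exact/C1_diff_map/fwd_C1].
    apply: le_trans (HLf _ _) _; rewrite ler_wpM2r ?tlength_ge0 //.
    by apply: le_trans (ler_norm _) _; rewrite lerDl.
  - rewrite [X in tlength g (X _) _]iterz_pred [X in tangent_diff X]iterz_pred.
    rewrite tangent_diff_comp;
      [|exact: iterz_diff_map | exact/C1_diff_map/bwd_C1].
    apply: le_trans (HLb _ _) _; rewrite ler_wpM2r ?tlength_ge0 //.
    by apply: le_trans (ler_norm _) _; rewrite lerDr.
exact: (iterated_growth (fun s m u => tlength_ge0 _ _ _) L0 step).
Qed.

End Iterates.

(* The bounds [um <= L * u0] and [v0 <= L * vm] cover a vanishing denominator. *)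
Lemma ratio_bound_mul (R : realFieldType) (um u0 vm v0 um' u0' vm' v0' q L : R) :
  0 <= um -> 0 <= u0 -> 0 <= vm -> 0 <= v0 -> um <= L * u0 -> v0 <= L * vm ->
  um = um' -> u0 = u0' -> vm = vm' -> v0 = v0' ->
  (u0' * vm' != 0 -> um' * v0' / (u0' * vm') <= q) -> um * v0 <= q * (u0 * vm).
Proof.
move=> um0 u00 vm0 v00 Lu Lv <- <- <- <-.
have [|den0 /(_ isT)] := eqVneq (u0 * vm) 0; last first.
  by rewrite ler_pdivrMr // lt_def den0 mulr_ge0.
move=> z _; rewrite z mulr0; move/eqP: z; rewrite mulf_eq0 => /orP[] /eqP z.
  by rewrite mulr_le0_ge0 // (le_trans Lu) // z mulr0.
by rewrite mulr_ge0_le0 // (le_trans Lv) // z mulr0.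
Qed.

(** * From domination to uniformly bounded projectors *)

Theorem lemma2p1 (R : realType) (d k : nat) (M : manifold R d) (g : metric M)
    (f : diffeo M) (Lambda : set M) (dims : 'I_k -> nat)
    (E : 'I_k -> forall x : M, {vspace tangent x})
    (P : 'I_k -> forall x : M, 'End(tangent x))
    (M_closed : compact [set: M]) (k_ge2 : (2 <= k)%N)
    (Lambda_compact : compact Lambda) (Lambda_invariant : f @` Lambda = Lambda)
    (f_dominated : dominated_splitting g f Lambda dims E P) :
  reducible g f Lambda P.
Proof.
have [Esplit _ _ Pproj [C [alpha [C1 a0 dom]]]] := f_dominated.
have growth := orbit_norm_growth f g M_closed.
(* The index [s] ranges over all of [M], while domination holds over [Lambda]; hence [Lambda s.1] is
   part of the predicate. *)
pose fiber (i : 'I_k) (s : M * int) (u : 'rV[R]_d) :=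
  Lambda s.1 /\ exists w, u = P i s.1 w.
have [|s m|s m u|s m u v||i j ij s u v m [xL [u' ->]] [_ [v' ->]]|K K0 HK] :=
  @dominated_sum_bound R (M * int)%type 'rV[R]_d (orbit_norm f g) k fiber C alpha
    _ _ _ _ growth _ a0.
- by move=> s m u; exact: tlength_ge0.
- by rewrite /orbit_norm /tangent_diff /chart_diff linear0 tlength0.
- by rewrite /orbit_norm /tangent_diff /chart_diff linearN tlengthN.
- by rewrite /orbit_norm /tangent_diff /chart_diff linearD tlengthD.
- by rewrite ltW // (lt_trans _ C1).
- set U := P i s.1 u'; set V := P j s.1 v'.
  have Nge0 p w : 0 <= orbit_norm f g s p w by exact: tlength_ge0.
  have [L HL] := growth m; have [LU _] := HL s U; have [_ LV] := HL s V.
  exact: (ratio_bound_mul (Nge0 _ _) (Nge0 _ _) (Nge0 _ _) (Nge0 _ _) LU LV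
    (@orbit_normE _ _ _ f g s m (P i s.1 u')) (@orbit_norm0E _ _ _ f g s (P i s.1 u'))
    (@orbit_normE _ _ _ f g s m (P j s.1 v')) (@orbit_norm0E _ _ _ f g s (P j s.1 v'))
    (dom i j ij s.1 xL u' v' m%:Z s.2 isT)).
(* [K] is only known to be nonnegative. *)
exists (K + 1); first by rewrite ltr_wpDl.
move=> i n x xL; apply: ge_ereal_sup => _ [u u1 <-]; rewrite lee_fin.
(* [w] is [Df^{-n}(f^n x) u] as a row vector, to be read as a tangent vector at [x]. *)
have [w wD wT] : exists2 w : 'rV[R]_d, Dpow f (- n) (iterz f n x) u = w
    & tangent_diff (iterz f (- n)) (iterz f n x) u = w.
  by exists (Dpow f (- n) (iterz f n x) u); [|exact: esym (tmapE _ _)].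
have wE : \sum_l P l x w = w.
  exact: oblique_projector_sum (Esplit x xL).2 (Pproj x xL) w.
have Hw := HK (x, n) (fun l => P l x w) (fun l => conj xL (ex_intro _ w erefl)).
rewrite wE in Hw.
(* [Df^n] undoes [Df^{-n}], so the whole sum has norm at most 1 at time [n]. *)
have wu : orbit_norm f g (x, n) 0 w = tlength g (iterz f n x) u.
  by rewrite orbit_norm0E tnorm_DpowE -wT tangent_diff_iterzK.
rewrite wu in Hw.
have <- : orbit_norm f g (x, n) 0 (P i x w) =
  tnorm g ((Dpow f n x \o P i x \o Dpow f (- n) (iterz f n x))%VF u).
  by rewrite !comp_lfunE -wD; exact: (@orbit_norm0E _ _ _ f g (x, n)).
have u1' : tlength g (iterz f n x) u <= 1 by exact: u1.
(* One component is bounded by the sum of the norms of all of them. *)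
apply: (@le_trans _ _ (\sum_l orbit_norm f g (x, n) 0 (P l x w))).
  by rewrite (bigD1 i) //= lerDl sumr_ge0 // => l _; exact: tlength_ge0.
apply: le_trans Hw _; apply: (@le_trans _ _ K); last by rewrite lerDl.
by rewrite ler_piMr.
Qed.
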